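(* Let $A \in \mathbb{R}^{m\times n}$ be a matrix with non-trivial null space, let $B \in \mathbb{R}^{p\times m}$ be any matrix, and set $C = BA$. Let $W \in \mathbb{R}^{n\times n}$ be the diagonal matrix defined by $W e_i = w_i e_i$ with $w_i = \|C e_i\|_2$, $i=1,\dots,n$. Let $j \in \{1,\dots,n\}$. Then $x_\alpha = \gamma_\alpha e_j$ is a minimizer of $$\min_{x \in \mathbb{R}^n} \left\{ \frac12 \|C x - C e_j\|_2^2 + \alpha \|W x\|_1 \right\},$$ where $\gamma_\alpha = 1 - \frac{\alpha}{w_j}$. If $$C e_l \neq c\, C e_q \quad \text{for all } l, q \in \{1,\dots,n\} \text{ with } l \neq q \text{ and all } c \in \mathbb{R},$$ then $x_\alpha = \gamma_\alpha e_j$ is the unique solution of this minimization problem.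
   Context: $e_1,\dots,e_n$ denote the standard Euclidean unit basis vectors of $\mathbb{R}^n$; $\|\cdot\|_1$ and $\|\cdot\|_2$ are the usual $\ell^1$- and Euclidean norms; $\alpha$ is the regularization parameter.
   Formalization: The formal theorem assumes 0 < α ≤ w_j: for α > w_j > 0 one has γ_α < 0 and x = 0 gives a strictly smaller value than γ_α e_j, for w_j = 0 γ_α is undefined, and for α = 0 uniqueness fails because of the null space. *)

(* Defs.v *)
From mathcomp Require Import all_boot all_order all_algebra.
From mathcomp Require Import reals.

Set Implicit Arguments.
Unset Strict Implicit.
Unset Printing Implicit Defensive.

Import Order.TTheory GRing.Theory Num.Theory.
Local Open Scope ring_scope.

(* The norm that MathComp-Analysis puts on matrices is the sup norm, so the
   l^1 and Euclidean norms of column vectors are defined here. *)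
Definition norm1 (R : realType) (n : nat) (x : 'cV[R]_n) : R :=
  \sum_i `|x i 0|.

Definition norm2 (R : realType) (n : nat) (x : 'cV[R]_n) : R :=
  Num.sqrt (\sum_i x i 0 ^+ 2).

Definition unitvec (R : realType) (n : nat) (i : 'I_n) : 'cV[R]_n :=
  delta_mx i 0.
Arguments unitvec {R n} i.

Definition nontrivial_nullspace (R : realType) (m n : nat)
    (A : 'M[R]_(m, n)) : Prop :=
  exists2 x : 'cV[R]_n, x != 0 & A *m x = 0.

Definition weight (R : realType) (p n : nat) (C : 'M[R]_(p, n)) (i : 'I_n) : R :=
  norm2 (C *m unitvec i).

Definition weight_mx (R : realType) (p n : nat) (C : 'M[R]_(p, n)) : 'M[R]_n :=
  diag_mx (\row_i weight C i).

Definition objective (R : realType) (p n : nat) (C : 'M[R]_(p, n)) (j : 'I_n)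
    (alpha : R) (x : 'cV[R]_n) : R :=
  2^-1 * norm2 (C *m x - C *m unitvec j) ^+ 2
    + alpha * norm1 (weight_mx C *m x).

Definition is_minimizer (R : realType) (T : Type) (f : T -> R) (x : T) : Prop :=
  forall y : T, f x <= f y.

Definition is_unique_minimizer (R : realType) (T : Type) (f : T -> R) (x : T) :
    Prop :=
  is_minimizer f x /\ forall y : T, is_minimizer f y -> y = x.

Lemma weight_mx_unitvec (R : realType) (p n : nat) (C : 'M[R]_(p, n))
    (i : 'I_n) :
  weight_mx C *m unitvec i = weight C i *: unitvec i.
Proof.
apply/matrixP=> k l; rewrite mul_diag_mx !mxE.
by case: eqVneq => [->|] //=; rewrite !mulr0.
Qed.

(* Main.v *)
Require Import Defs.
From mathcomp Require Import all_boot all_order all_algebra.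
From mathcomp Require Import reals.
From mathcomp Require Import ring lra.

(** With [c = C e_j], [w = w_j] and [u = C x - c + (alpha / w) c], expanding the
    square shows that the objective at [x] equals
    [alpha w - alpha^2 / 2 + |u|^2 / 2
       + alpha * \sum_i (w_i |x_i| - x_i <C e_i, c> / w)].
    Every summand is nonnegative by Cauchy-Schwarz, and all of them, as well as
    [u], vanish at [gamma e_j]. At a minimizer they all vanish too; the equality
    case of Cauchy-Schwarz then makes [C e_i] a multiple of [c] whenever
    [x_i != 0], so that under the hypothesis on the columns of [C] only [x_j]
    survives, and [u = 0] determines it. *)

Set Implicit Arguments.
Unset Strict Implicit.
Unset Printing Implicit Defensive.

Import Order.TTheory GRing.Theory Num.Theory.
Local Open Scope ring_scope.

Section Dot.
Variables (R : realType) (n : nat).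
Implicit Types u v c : 'cV[R]_n.

Definition dot u v : R := \sum_i u i 0 * v i 0.

Lemma dotDl u1 u2 v : dot (u1 + u2) v = dot u1 v + dot u2 v.
Proof. by rewrite -big_split; apply: eq_bigr => i _; rewrite mxE mulrDl. Qed.

Lemma dotZl a u v : dot (a *: u) v = a * dot u v.
Proof. by rewrite mulr_sumr; apply: eq_bigr => i _; rewrite mxE mulrA. Qed.

Lemma dotC u v : dot u v = dot v u.
Proof. by apply: eq_bigr => i _; rewrite mulrC. Qed.

Lemma dot_sqrDZ u v a :
  dot (u + a *: v) (u + a *: v) = dot u u + 2 * a * dot u v + a ^+ 2 * dot v v.
Proof.
by rewrite dotDl !(dotC _ (u + _)) !dotDl !dotZl !(dotC _ (a *: v)) !dotZl
  (dotC v u); ring.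
Qed.

Lemma dot_ge0 u : 0 <= dot u u.
Proof. by apply: sumr_ge0 => i _; rewrite -expr2 sqr_ge0. Qed.

Lemma dot_eq0 u : dot u u = 0 -> u = 0.
Proof.
move=> /eqP; rewrite psumr_eq0; last by move=> i _; rewrite -expr2 sqr_ge0.
move=> /allP u0; apply/colP => i; rewrite mxE.
by have := u0 i (mem_index_enum i); rewrite /= mulf_eq0 orbb => /eqP.
Qed.

Lemma norm2_ge0 u : 0 <= norm2 u.
Proof. exact: sqrtr_ge0. Qed.

Lemma sqr_norm2 u : norm2 u ^+ 2 = dot u u.
Proof.
rewrite sqr_sqrtr; first by apply: eq_bigr => i _; rewrite expr2.
by apply: sumr_ge0 => i _; exact: sqr_ge0.
Qed.

(** Here [r] is what remains of [u] after orthogonal projection onto the line of [c]. Since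
    [dot r r] is nonnegative and vanishes only for [r = 0], this one identity yields both
    Cauchy-Schwarz and its equality case. *)
Lemma dot_residual u c (r := u - (dot u c / dot c c) *: c) :
  0 < dot c c -> dot r r * dot c c = (norm2 u * norm2 c) ^+ 2 - dot u c ^+ 2.
Proof.
move=> c0; rewrite exprMn !sqr_norm2 /r -scaleNr dot_sqrDZ.
by field; rewrite gt_eqF.
Qed.

Lemma cauchy_schwarz u c : 0 < dot c c -> `|dot u c| <= norm2 u * norm2 c.
Proof.
move=> c0; rewrite -ler_sqr ?nnegrE ?normr_ge0 ?mulr_ge0 ?norm2_ge0 //.
by rewrite real_normK ?num_real // -subr_ge0 -dot_residual // mulr_ge0 ?dot_ge0.
Qed.

Lemma cauchy_schwarz_eq u c : 0 < dot c c ->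
  norm2 u * norm2 c <= `|dot u c| -> u = (dot u c / dot c c) *: c.
Proof.
move=> c0 le_uc; apply/eqP; rewrite -subr_eq0; apply/eqP/dot_eq0.
have E : norm2 u * norm2 c = `|dot u c|.
  by apply/le_anti; rewrite le_uc cauchy_schwarz.
have := dot_residual u c0.
rewrite E real_normK ?num_real // subrr => /eqP.
by rewrite mulf_eq0 (gt_eqF c0) orbF => /eqP.
Qed.

End Dot.

Lemma mulmx_sum_unitvec (R : realType) (p n : nat) (C : 'M[R]_(p, n)) x :
  C *m x = \sum_i x i 0 *: (C *m unitvec i).
Proof.
rewrite [in LHS](matrix_sum_delta x) mulmx_sumr; apply: eq_bigr => i _.
by rewrite big_ord1 -scalemxAr.
Qed.

Lemma dot_mulmx (R : realType) (p n : nat) (C : 'M[R]_(p, n)) x v :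
  dot (C *m x) v = \sum_i x i 0 * dot (C *m unitvec i) v.
Proof.
rewrite mulmx_sum_unitvec.
(* The vector sum and the scalar sum are built up in parallel, keeping the relation that the first
   dotted with [v] equals the second. *)
elim/big_ind2: _ => [|u a w b <- <-|i _]; last exact: dotZl.
  by rewrite /dot big1 // => k _; rewrite mxE mul0r.
exact: dotDl.
Qed.

Lemma norm1_weight_mx (R : realType) (p n : nat) (C : 'M[R]_(p, n)) x :
  norm1 (weight_mx C *m x) = \sum_i weight C i * `|x i 0|.
Proof.
apply: eq_bigr => i _.
by rewrite mul_diag_mx !mxE normrM ger0_norm ?norm2_ge0.
Qed.

Section Objective.
Variables (R : realType) (p n : nat) (C : 'M[R]_(p, n)) (j : 'I_n) (alpha : R).
Hypotheses (alpha_gt0 : 0 < alpha) (alpha_le : alpha <= weight C j).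
Let c := C *m unitvec j.
Let w := weight C j.

Let w_gt0 : 0 < w. Proof. exact: lt_le_trans alpha_le. Qed.

Let dot_cc : dot c c = w ^+ 2. Proof. by rewrite -sqr_norm2. Qed.

Let dot_cc_gt0 : 0 < dot c c. Proof. by rewrite dot_cc exprn_gt0. Qed.

Definition gap (x : 'cV[R]_n) i : R :=
  weight C i * `|x i 0| - x i 0 * dot (C *m unitvec i) c / w.

(** Vanishes exactly when [C *m x] is [1 - alpha / w] times [c]. *)
Definition residual (x : 'cV[R]_n) := C *m x - c + (alpha / w) *: c.

Lemma sum_gap x : \sum_i gap x i =
  \sum_i weight C i * `|x i 0| - dot (C *m x) c / w.
Proof. by rewrite sumrB dot_mulmx mulr_suml. Qed.

(** The cross term of the square is [alpha / w] times [dot (C *m x) c - w ^+ 2]: its first part is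
    absorbed by the gaps, its second gives the constant [alpha * w]. *)
Lemma objectiveE x : objective C j alpha x =
  alpha * w - alpha ^+ 2 / 2 + 2^-1 * dot (residual x) (residual x)
    + alpha * \sum_i gap x i.
Proof.
rewrite /objective norm1_weight_mx sqr_norm2 /residual dot_sqrDZ -/c.
rewrite (dotDl _ _ c) -(scaleN1r c) dotZl dot_cc sum_gap.
by field; rewrite gt_eqF.
Qed.

Lemma gap_ge0 x i : 0 <= gap x i.
Proof.
rewrite subr_ge0 ler_pdivrMr //; apply: le_trans (ler_norm _) _.
rewrite normrM mulrAC mulrC ler_wpM2r ?normr_ge0 //.
exact: cauchy_schwarz.
Qed.

Lemma gap_eq0 x i : gap x i = 0 -> x i 0 != 0 ->
  exists a, C *m unitvec i = a *: c.
Proof.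
move=> /eqP; rewrite subr_eq0 => /eqP E x0.
exists (dot (C *m unitvec i) c / dot c c).
apply: cauchy_schwarz_eq => //.
(* Scaling by the positive number [|x i 0|] brings in the product that the vanishing gap
   evaluates. *)
rewrite -(ler_pM2l (x := `|x i 0|)) ?normr_gt0 // -normrM.
apply: le_trans (ler_norm _); rewrite -(divfK (lt0r_neq0 w_gt0) (x i 0 * _)).
by rewrite -E mulrA (mulrC `|_|).
Qed.

Let gamma := 1 - alpha / w.

(** Since [c] is nonzero, this singles out [gamma] on the line of [unitvec j], which serves both
    existence and uniqueness. *)
Lemma residual_unitvec a : residual (a *: unitvec j) = (a - gamma) *: c.
Proof.
rewrite /residual -scalemxAr -/c -{2}(scale1r c) -scalerBl -scalerDl.
by congr (_ *: _); rewrite /gamma; ring.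
Qed.

Lemma gap_unitvec i : gap (gamma *: unitvec j) i = 0.
Proof.
(* This is where [alpha <= w] enters: without the sign of [gamma], the absolute value in the gap at
   [j] would not cancel. *)
have gamma_ge0 : 0 <= gamma by rewrite subr_ge0 ler_pdivrMr ?mul1r.
rewrite /gap !mxE eqxx andbT.
have [->|_] := eqVneq i j; last by rewrite mulr0 normr0 mulr0 !mul0r subrr.
rewrite mulr1 ger0_norm // dot_cc -/w.
by field; rewrite gt_eqF.
Qed.

Lemma objective_min :
  objective C j alpha (gamma *: unitvec j) = alpha * w - alpha ^+ 2 / 2.
Proof.
rewrite objectiveE residual_unitvec subrr dotZl mul0r.
by rewrite big1 => [|i _]; rewrite ?gap_unitvec // !mulr0 !addr0.
Qed.

Lemma minimizer : is_minimizer (objective C j alpha) (gamma *: unitvec j).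
Proof.
move=> x; rewrite objective_min objectiveE -addrA lerDl.
rewrite addr_ge0 ?mulr_ge0 ?dot_ge0 ?invr_ge0 ?ler0n ?(ltW alpha_gt0) //.
by apply: sumr_ge0 => i _; exact: gap_ge0.
Qed.

Lemma minimizer_eq0 x : is_minimizer (objective C j alpha) x ->
  residual x = 0 /\ forall i, gap x i = 0.
Proof.
move=> /(_ (gamma *: unitvec j)); rewrite objective_min objectiveE -addrA.
have gap0 : 0 <= \sum_i gap x i by apply: sumr_ge0 => i _; exact: gap_ge0.
have := dot_ge0 (residual x); rewrite gerDl => res0 le0.
have agap0 := mulr_ge0 (ltW alpha_gt0) gap0.
(* Two nonnegative terms have a sum at most 0, so each is 0. *)
split; first by apply: dot_eq0; lra.
have /eqP : alpha * \sum_i gap x i = 0 by lra.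
rewrite mulf_eq0 (gt_eqF alpha_gt0) /= psumr_eq0 => [|i _];
  last exact: gap_ge0.
by move=> /allP gap_eq0 i; apply/eqP/gap_eq0/mem_index_enum.
Qed.

Lemma minimizer_unique x :
  (forall l : 'I_n, l != j -> forall a, C *m unitvec l <> a *: c) ->
  is_minimizer (objective C j alpha) x -> x = gamma *: unitvec j.
Proof.
move=> indep /minimizer_eq0[res0 gap0].
have xE : x = x j 0 *: unitvec j.
  apply/colP => i; rewrite !mxE eqxx andbT.
  have [->|ij] := eqVneq i j; first by rewrite mulr1.
  rewrite mulr0; apply/eqP/negPn/negP => /(gap_eq0 (gap0 i))[a].
  exact: indep.
move: res0; rewrite xE residual_unitvec => /eqP.
rewrite scaler_eq0 subr_eq0 => /orP[/eqP-> //|/eqP c0].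
by move: dot_cc_gt0; rewrite c0 -(scale0r c) dotZl mul0r ltxx.
Qed.

End Objective.

Theorem theorem3p3 (R : realType) (m n p : nat)
    (A : 'M[R]_(m, n)) (B : 'M[R]_(p, m)) (C : 'M[R]_(p, n))
    (hA : nontrivial_nullspace A) (hC : C = B *m A)
    (j : 'I_n) (alpha : R)
    (halpha : 0 < alpha) (halphaw : alpha <= weight C j) :
  let gamma := 1 - alpha / weight C j in
  is_minimizer (objective C j alpha) (gamma *: unitvec j) /\
  ((forall l q : 'I_n, l != q ->
      forall c : R, C *m unitvec l <> c *: (C *m unitvec q)) ->
   is_unique_minimizer (objective C j alpha) (gamma *: unitvec j)).
Proof.
move=> gamma; split=> [|indep]; first exact: minimizer.
split=> [|x]; first exact: minimizer.
by apply: minimizer_unique => // l; exact: indep.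
Qed.
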